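(* There exist a complex Hilbert space and two unbounded self-adjoint operators $A$ and $B$ on it such that $AB-BA$ is bounded and closed, whilst $|A|B-B|A|$ is unbounded and closed.
   Context: Operators are linear maps $T$ defined on a linear subspace $D(T)$ of a Hilbert space $\mathcal H$ with values in $\mathcal H$. An operator $T$ is called bounded if there is a constant $M\ge 0$ with $\|Tx\|\le M\|x\|$ for all $x\in D(T)$ (boundedness is on its own domain, which need not be dense and may even be $\{0\}$), and unbounded otherwise. It is closed if its graph is closed in $\mathcal H\oplus\mathcal H$. Products and differences have their natural domains $D(ST)=\{x\in D(T): Tx\in D(S)\}$ and $D(S-T)=D(S)\cap D(T)$. For a self-adjoint operator $A$, $|A|=(A^*A)^{1/2}=(A^2)^{1/2}$ is the unique positive self-adjoint square root of $A^2$. *)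

(* Defs.v *)
From HB Require Import structures.
From mathcomp Require Import all_boot all_order all_algebra.
From mathcomp Require Import sesquilinear complex.
From mathcomp Require Import all_classical all_reals all_analysis.

Set Implicit Arguments.
Unset Strict Implicit.
Unset Printing Implicit Defensive.

Import Order.TTheory GRing.Theory Num.Theory.
Import numFieldNormedType.Exports.

Local Open Scope classical_set_scope.
Local Open Scope ring_scope.
Local Open Scope complex_scope.

(* Complex Hilbert spaces: Banach spaces over R[i] whose norm is induced by an
   inner product, linear on the left and conjugate-linear on the right. Norms
   take their values in R[i], as for every normedModType over R[i]. *)
HB.mixin Record CompleteNormedModule_isHilbert (R : realType) H
    & CompleteNormedModule R[i] H := {
  inner : {dot H for (@Num.conj R[i])} ;
  sqr_norm_inner : forall x : H, `|x| ^+ 2 = inner x x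
}.

#[short(type="hilbertType")]
HB.structure Definition Hilbert (R : realType) :=
  {H of CompleteNormedModule_isHilbert R H & CompleteNormedModule R[i] H}.

Section Operators.
Context {R : realType} {H : hilbertType R}.

(* The values of [op_fun] outside of [op_dom] are irrelevant: everything below
   depends on an operator only through its graph. *)
Record operator := Operator {
  op_dom : set H ;
  op_fun :> H -> H ;
  op_dom0 : op_dom 0 ;
  op_domP : forall (a : R[i]) (x y : H),
    op_dom x -> op_dom y -> op_dom (a *: x + y) ;
  op_linear : forall (a : R[i]) (x y : H),
    op_dom x -> op_dom y -> op_fun (a *: x + y) = a *: op_fun x + op_fun y
}.

Implicit Types S T : operator.

Definition graph T : set (H * H) := [set p | op_dom T p.1 /\ p.2 = T p.1].

Definition bounded_op T : Prop :=
  exists M : R, 0 <= M /\ forall x, op_dom T x -> `|T x| <= M%:C * `|x|.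

Definition unbounded_op T : Prop := ~ bounded_op T.

(* The product topology of [H * H] is that of the Hilbert sum of H with H. *)
Definition closed_op T : Prop := closed (graph T).

Definition mul_dom S T : set H := [set x | op_dom T x /\ op_dom S (T x)].

Lemma mul_dom0 S T : mul_dom S T 0.
Proof.
have T0 : T 0 = 0.
  have := op_linear (-1) (op_dom0 T) (op_dom0 T).
  by rewrite scaler0 addr0 scaleN1r addNr.
by split; rewrite ?T0; exact: op_dom0.
Qed.

Lemma mul_domP S T (a : R[i]) (x y : H) :
  mul_dom S T x -> mul_dom S T y -> mul_dom S T (a *: x + y).
Proof.
move=> [Tx STx] [Ty STy]; split; first exact: op_domP.
by rewrite op_linear//; exact: op_domP.
Qed.

Lemma mul_linear S T (a : R[i]) (x y : H) :
  mul_dom S T x -> mul_dom S T y ->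
  S (T (a *: x + y)) = a *: S (T x) + S (T y).
Proof. by move=> [Tx STx] [Ty STy]; rewrite !op_linear. Qed.

Definition mul_op S T : operator :=
  Operator (mul_dom0 S T) (@mul_domP S T) (@mul_linear S T).

Definition sub_dom S T : set H := op_dom S `&` op_dom T.

Lemma sub_dom0 S T : sub_dom S T 0.
Proof. by split; exact: op_dom0. Qed.

Lemma sub_domP S T (a : R[i]) (x y : H) :
  sub_dom S T x -> sub_dom S T y -> sub_dom S T (a *: x + y).
Proof. by move=> [Sx Tx] [Sy Ty]; split; exact: op_domP. Qed.

Lemma sub_linear S T (a : R[i]) (x y : H) :
  sub_dom S T x -> sub_dom S T y ->
  S (a *: x + y) - T (a *: x + y) = a *: (S x - T x) + (S y - T y).
Proof.
by move=> [Sx Tx] [Sy Ty]; rewrite !op_linear// scalerBr opprD addrACA.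
Qed.

Definition sub_op S T : operator :=
  Operator (sub_dom0 S T) (@sub_domP S T) (@sub_linear S T).

(* The graph of the adjoint of T, when T is densely defined; otherwise this set
   is not the graph of a function. *)
Definition adjoint_graph T : set (H * H) :=
  [set p | forall x, op_dom T x -> inner (T x) p.1 = inner x p.2].

Definition self_adjoint T : Prop :=
  dense (op_dom T) /\ graph T = adjoint_graph T.

Definition positive_op T : Prop :=
  forall x, op_dom T x -> 0 <= inner (T x) x.

(* [is_abs_op A P] says that P = |A| for a self-adjoint A: the positive
   self-adjoint square root of A^2 is unique as an operator, hence P is
   determined up to its irrelevant values. *)
Definition is_abs_op (A P : operator) : Prop :=
  [/\ self_adjoint P, positive_op P & graph (mul_op P P) = graph (mul_op A A)].

End Operators.

Arguments operator {R} H.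

Declare Scope operator_scope.
Delimit Scope operator_scope with op.
Bind Scope operator_scope with operator.
Notation "S * T" := (mul_op S T) : operator_scope.
Notation "S - T" := (sub_op S T) : operator_scope.

(* Main.v *)
From HB Require Import structures.
Require Import Defs.
From mathcomp Require Import all_boot all_order all_algebra.
From mathcomp Require Import sesquilinear complex ring lra.
From mathcomp Require Import all_classical all_reals all_analysis.

Set Implicit Arguments.
Unset Strict Implicit.
Unset Printing Implicit Defensive.

Import Order.TTheory GRing.Theory Num.Theory.
Import numFieldNormedType.Exports.

Local Open Scope classical_set_scope.
Local Open Scope ring_scope.
Local Open Scope complex_scope.

Local Notation Re := complex.Re.
Local Notation Im := complex.Im.

(** Split the space as H = K + K. For a positive self-adjoint S on K and
    self-adjoint T1, T2 on K, let A exchange the two summands through S, that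
    is A (x, y) = (S y, S x), and let B (x, y) = (T1 x, T2 y). Then
    |A| (x, y) = (S x, S y), and the two commutators are

      (A B - B A) (x, y) = ((S T2 - T1 S) y, (S T1 - T2 S) x),
      (|A| B - B |A|) (x, y) = ((S T1 - T1 S) x, (S T2 - T2 S) y).

    The first one mixes T1 and T2, the second one does not. If the domains of T2
    and S meet only at 0, then S T2 - T2 S has domain 0. If moreover S is
    injective and maps the domain of S T1 into that of S, then S T1 - T2 S and
    S T2 - T1 S have domain 0 as well. So A B - B A has domain 0, hence is bounded and closed, whereas
    |A| B - B |A| reduces to S T1 - T1 S on the first summand.

    Take K = l2 (x) C^2, D = diag (2 ^ n) on l2, S = D (x) diag (1, 2) and
    T1 = D (x) swap. Then S T1 - T1 S = D ^ 2 (x) [[0, -1], [1, 0]], which is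
    closed, being defined on its maximal domain, and unbounded.

    It remains to find T2. It is L^* (D (x) swap) L, which is self-adjoint for
    every bounded L with a bounded inverse ([conj_self_adjoint]), and whose
    domain is the set of the x such that L x is in the domain of D (x) 1, which
    is also that of S. The map L is a product of two shears 1 + V, where V moves
    one coordinate of C^2 to the other one through f |-> g with
    g n = 2 ^- n * f (p n), and p is the 2-adic valuation. Since p takes every
    value infinitely often, 2 ^ n * g n = f (p n) is square-summable only for
    f = 0. So, if x and (1 + V) x are in the domain of S, then V x is also in it,
    and the coordinate of x that V reads is 0. The two shears read the two
    coordinates, so that x and L x are both in the domain of S only for x = 0
    ([straighten_decay]).

    In the code K + K is l2 over [nat * (bool * bool)]: the first boolean
    selects the summand, [false] being the first one, and the second boolean is
    the coordinate in C^2. The space l2, its completeness and the adjoints of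
    bounded operators ([adjoint_exists]) are constructed from series. *)

(** * The Cauchy-Schwarz inequality *)

Section CauchySchwarz.
Variables (C : numClosedFieldType) (U : lmodType C).
Variable form : {dot U for (@Num.conj C)}.

(** Stated for an arbitrary definite form, because it is used twice: it gives
    the triangle inequality from which the norm of l2 is built, and then the
    boundedness of the inner product of a Hilbert space. *)
Lemma dot_CauchySchwarz (u v : U) :
  `|form u v| ^+ 2 <= form u u * form v v.
Proof.
have [->|v0] := eqVneq v 0.
  by rewrite !(linear0r form) normr0 expr0n mulr0.
have vv0 : form v v != 0 by rewrite dnorm_eq0.
pose a := form u v / form v v.
have [w wv uE] : exists2 w, form w v = 0 & u = w + a *: v.
  exists (u - a *: v); last by rewrite subrK.
  by rewrite linearBl/= linearZl_LR/= divfK// subrr.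
have -> : form u u = form w w + `|a| ^+ 2 * form v v.
  have wav : form w (a *: v) = 0 by rewrite linearZr_LR/= wv mulr0.
  by rewrite uE hnormDd//= dnormZ.
have -> : `|form u v| ^+ 2 = `|a| ^+ 2 * form v v * form v v.
  rewrite {1}(_ : form u v = a * form v v); last by rewrite /a divfK.
  by rewrite normrM exprMn (ger0_norm (dnorm_ge0 _ _)) expr2 mulrA.
by rewrite ler_wpM2r ?dnorm_ge0// lerDr dnorm_ge0.
Qed.

Lemma dot_CauchySchwarz_sqrt (u v : U) :
  `|form u v| <= sqrtC (form u u) * sqrtC (form v v).
Proof.
rewrite -(@ler_pXn2r _ 2)// ?nnegrE ?mulr_ge0 ?sqrtC_ge0 ?dnorm_ge0//.
by rewrite exprMn !sqrtCK dot_CauchySchwarz.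
Qed.

Lemma dot_triangle (u v : U) :
  sqrtC (form (u + v) (u + v)) <= sqrtC (form u u) + sqrtC (form v v).
Proof.
have su := sqrt_dnorm_ge0 form u; have sv := sqrt_dnorm_ge0 form v.
rewrite -(@ler_pXn2r _ 2)// ?nnegrE ?addr_ge0 ?sqrt_dnorm_ge0//.
rewrite sqrrD !sqrtCK dnormD addrAC lerD2r lerD2l.
apply: le_trans (_ : (`|form u v| : C) *+ 2 <= _).
  rewrite -mulr_natr -[_ + _](divfK (negbT (pnatr_eq0 C 2))) -ReE.
  by rewrite ler_pM2r ?ltr0n// (leif_Re_Creal (form u v)).
by rewrite lerMn2r/= dot_CauchySchwarz_sqrt.
Qed.

End CauchySchwarz.

(** * Square-summable families *)

Lemma gt0_complexE (R : realType) (e : R[i]) : 0 < e -> e = (Re e)%:C /\ 0 < Re e.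
Proof. by case: e => a b; rewrite ltcE/= => /andP[/eqP -> ->]. Qed.

Section SquaredModulus.
Variable R : realType.
Implicit Types z : R[i].

Definition normsq (z : R[i]) : R := Re z ^+ 2 + Im z ^+ 2.

Lemma normsq_ge0 z : 0 <= normsq z.
Proof. by rewrite addr_ge0// sqr_ge0. Qed.

Lemma normsqM (a : R[i]) z : normsq (a * z) = normsq a * normsq z.
Proof. by rewrite /normsq; case: a z => [? ?] [? ?] /=; ring. Qed.

Lemma normsq_real (a : R) : normsq a%:C = a ^+ 2.
Proof. by rewrite /normsq/= expr0n addr0. Qed.

Lemma normsq_eq0 z : normsq z <= 0 -> z = 0.
Proof.
case: z => a b; rewrite /normsq/= => ab.
have [a0 b0] : a ^+ 2 = 0 /\ b ^+ 2 = 0.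
  by have := sqr_ge0 a; have := sqr_ge0 b; split; lra.
by move/eqP: a0; move/eqP: b0; rewrite !sqrf_eq0 => /eqP -> /eqP ->.
Qed.

End SquaredModulus.

Section SquareSummable.
Variables (R : realType) (T : finType).
Implicit Types (f g : nat -> T -> R[i]).

Definition dotRe f g : nat -> R := fun n =>
  \sum_t (Re (f n t) * Re (g n t) + Im (f n t) * Im (g n t)).

(** The families are indexed by [nat * T] with [T] finite, and summed over
    [nat] only: permuting [T] inside each term of the series does not disturb
    the order of summation, so the reindexings below never need unconditional
    convergence. *)
Definition sqsummable f : Prop := cvgn (series (dotRe f f)).

Lemma dotReE f n : dotRe f f n = \sum_t normsq (f n t).
Proof. by apply: eq_bigr => t _; rewrite -!expr2. Qed.

Lemma dotRe_ge0 f n : 0 <= dotRe f f n.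
Proof. by rewrite dotReE sumr_ge0// => t _; exact: normsq_ge0. Qed.

Lemma sqsummable_le f (u : nat -> R) : (forall n, dotRe f f n <= u n) ->
  cvgn (series u) -> sqsummable f.
Proof.
move=> fu; apply: series_le_cvg => //; first exact: dotRe_ge0.
by move=> n; exact: le_trans (dotRe_ge0 _ _) (fu n).
Qed.

Lemma sqsummable_bounded f M :
  (forall N, series (dotRe f f) N <= M) -> sqsummable f.
Proof.
move=> fM; apply: nondecreasing_is_cvgn.
  by apply: nondecreasing_series => n _ _; exact: dotRe_ge0.
by exists M => _ [N _ <-].
Qed.

Lemma sqsummable0 : sqsummable 0.
Proof.
apply: (@sqsummable_bounded _ 0) => N.
rewrite /series/= big1// => n _.
by rewrite /dotRe big1// => t _; rewrite /= !mulr0 addr0.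
Qed.

Lemma sqsummableD (a : R[i]) f g :
  sqsummable f -> sqsummable g -> sqsummable (a *: f + g).
Proof.
move=> sf sg; pose K := (Re a ^+ 2 + Im a ^+ 2) *+ 2.
apply: (@sqsummable_le _ (K *: dotRe f f + 2 *: dotRe g g)); last first.
  by apply: is_cvg_seriesD; apply: is_cvg_seriesZ.
move=> n; rewrite -[leRHS]/(K * dotRe f f n + 2 * dotRe g g n).
rewrite /dotRe !mulr_sumr -big_split/=; apply: ler_sum => t _.
rewrite -[(a *: f + g) n t]/(a * f n t + g n t) /K.
case: a {K} => a b; case: (f n t) => x y; case: (g n t) => z w /=.
set p := a * x - b * y; set q := a * y + b * x.
have -> : (a ^+ 2 + b ^+ 2) *+ 2 * (x * x + y * y) = (p * p + q * q) *+ 2.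
  by rewrite /p /q; ring.
have := sqr_ge0 (p - z); have := sqr_ge0 (q - w); rewrite !expr2; nra.
Qed.

Lemma cvg_dotRe f g : sqsummable f -> sqsummable g ->
  cvgn (series (dotRe f g)).
Proof.
move=> sf sg; apply: (@normed_cvg R R).
apply: (@series_le_cvg _ _ (dotRe f f + dotRe g g)).
- by move=> n; exact: normr_ge0.
- by move=> n; rewrite addr_ge0// dotRe_ge0.
- move=> n; apply: le_trans (ler_norm_sum _ _ _) _.
  rewrite -[leRHS]/(dotRe f f n + dotRe g g n).
  rewrite /dotRe -big_split/=; apply: ler_sum => t _.
  move: (Re _) (Im _) (Re _) (Im _) => x y z w.
  have := sqr_ge0 (x - z); have := sqr_ge0 (y - w).
  have := sqr_ge0 (x + z); have := sqr_ge0 (y + w).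
  rewrite !expr2 => ? ? ? ?.
  by rewrite ler_norml; apply/andP; split; nra.
- exact: is_cvg_seriesD.
Qed.

Definition sqsummable_pred : {pred nat -> T -> R[i]} :=
  fun f => `[< sqsummable f >].

Lemma sqsummable_submod : subsemimod_closed sqsummable_pred.
Proof.
split; [split|].
- by apply/asboolP; exact: sqsummable0.
- move=> f g /asboolP sf /asboolP sg; apply/asboolP.
  by rewrite -[f]scale1r; exact: sqsummableD.
- move=> a f /asboolP sf; apply/asboolP.
  by rewrite -[_ *: _]addr0; apply: sqsummableD => //; exact: sqsummable0.
Qed.

HB.instance Definition _ :=
  GRing.isSubSemiModClosed.Build R[i] (nat -> T -> R[i]) sqsummable_pred
    sqsummable_submod.

Record l2 := L2 { l2val :> nat -> T -> R[i]; l2P : l2val \in sqsummable_pred }.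

HB.instance Definition _ := [isSub for l2val].
HB.instance Definition _ := [Choice of l2 by <:].
HB.instance Definition _ := [SubChoice_isSubLmodule of l2 by <:].

End SquareSummable.

(** * The inner product of l2 *)

Section InnerProduct.
Variables (R : realType) (T : finType).
Implicit Types (x y z : l2 R T).

Lemma l2_eqP x y : (forall n t, x n t = y n t) -> x = y.
Proof. by move=> xy; apply/val_inj/funext => n; apply/funext => t; exact: xy. Qed.

Lemma sqsummable_l2 x : sqsummable x.
Proof. by apply/asboolP; exact: (l2P x). Qed.

(** The real inner product underlying the complex one. Every algebraic law is
    first proved for it, where it is a termwise identity between real series
    by [rdot_lin]; multiplication by 'i then yields the imaginary part. *)
Definition rdot x y : R := limn (series (dotRe x y)).

Lemma cvg_rdot x y : series (dotRe x y) @ \oo --> rdot x y.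
Proof. by apply: cvg_dotRe; exact: sqsummable_l2. Qed.

Lemma rdot_lin (a b : R) x y x1 y1 x2 y2 :
  (forall n t, Re (x n t) * Re (y n t) + Im (x n t) * Im (y n t) =
     a * (Re (x1 n t) * Re (y1 n t) + Im (x1 n t) * Im (y1 n t)) +
     b * (Re (x2 n t) * Re (y2 n t) + Im (x2 n t) * Im (y2 n t))) ->
  rdot x y = a * rdot x1 y1 + b * rdot x2 y2.
Proof.
move=> xyE; rewrite /rdot.
have -> : series (dotRe x y) =
    (fun N => a * series (dotRe x1 y1) N + b * series (dotRe x2 y2) N).
  apply/funext => N; rewrite /series/=.
  rewrite !mulr_sumr -big_split; apply: eq_bigr => n _ /=.
  by rewrite /dotRe !mulr_sumr -big_split; apply: eq_bigr.
by apply: cvg_lim => //; apply: cvgD; apply: cvgMl_tmp; exact: cvg_rdot.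
Qed.

Lemma rdotC x y : rdot x y = rdot y x.
Proof.
rewrite [RHS](_ : _ = 1 * rdot y x + 0 * rdot y x); last by ring.
by apply: rdot_lin => n t; ring.
Qed.

Lemma rdotDl x y z : rdot (x + y) z = rdot x z + rdot y z.
Proof.
rewrite [RHS](_ : _ = 1 * rdot x z + 1 * rdot y z); last by ring.
apply: rdot_lin => n t; rewrite -[(x + y) n t]/(x n t + y n t).
by case: (x n t) (y n t) (z n t) => [? ?] [? ?] [? ?] /=; ring.
Qed.

Lemma rdotZl (a : R[i]) x y :
  rdot (a *: x) y = Re a * rdot x y + Im a * rdot ('i%C *: x) y.
Proof.
apply: rdot_lin => n t; rewrite -[(a *: x) n t]/(a * x n t).
rewrite -[('i%C *: x) n t]/('i%C * x n t).
by case: a (x n t) (y n t) => [? ?] [? ?] [? ?] /=; ring.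
Qed.

Lemma rdot_il x y : rdot ('i%C *: x) y = - rdot x ('i%C *: y).
Proof.
rewrite [RHS](_ : _ = (-1) * rdot x ('i%C *: y) + 0 * rdot x x); last by ring.
apply: rdot_lin => n t; rewrite -[('i%C *: x) n t]/('i%C * x n t).
rewrite -[('i%C *: y) n t]/('i%C * y n t).
by case: (x n t) (y n t) => [? ?] [? ?] /=; ring.
Qed.

Lemma rdot_ii x y : rdot ('i%C *: x) ('i%C *: y) = rdot x y.
Proof.
rewrite rdot_il scalerA (_ : 'i%C * 'i%C = -1); last first.
  by rewrite -expr2 sqr_i.
by rewrite rdotC rdotZl/= oppr0 mul0r addr0 mulN1r opprK rdotC.
Qed.

Definition l2dot x y : R[i] := rdot x y +i* rdot x ('i%C *: y).

Lemma l2dotC x y : l2dot x y = (-1) ^+ false * Num.conj (l2dot y x).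
Proof.
rewrite expr0 mul1r /l2dot [RHS]/=; congr (_ +i* _); first exact: rdotC.
by rewrite rdotC rdot_il.
Qed.

Lemma l2dotDl z : {morph l2dot^~ z : x y / x + y}.
Proof. by move=> x y; rewrite /l2dot !rdotDl. Qed.

Lemma l2dotZl z : scalable_for *%R (l2dot^~ z).
Proof.
move=> a x; rewrite /l2dot !(rdotZl a) rdot_ii rdot_il.
by case: a => a b /=; congr (_ +i* _); ring.
Qed.

Lemma l2dot_zmodl z : zmod_morphism (l2dot^~ z).
Proof.
move=> x y; rewrite -scaleN1r l2dotDl; congr (_ + _).
by rewrite (l2dotZl z (-1) y) mulN1r.
Qed.

Lemma l2dot_zmodr z : zmod_morphism (l2dot z).
Proof.
move=> x y; rewrite [LHS]l2dotC [in RHS]l2dotC [l2dot z y]l2dotC !expr0 !mul1r.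
by rewrite -rmorphB; congr (Num.conj _); exact: l2dot_zmodl.
Qed.

Lemma l2dotZr z : scalable_for ((@Num.conj R[i]) \; *%R) (l2dot z).
Proof.
move=> a x /=; rewrite [LHS]l2dotC [in RHS]l2dotC !expr0 !mul1r.
by rewrite -rmorphM; congr (Num.conj _); exact: l2dotZl.
Qed.

Lemma sum_coord_le N x : series (dotRe x x) N <= rdot x x.
Proof.
apply: nondecreasing_cvgn_le; last exact: cvg_rdot.
by apply: nondecreasing_series => n _ _; exact: dotRe_ge0.
Qed.

Lemma rdot_ge0 x : 0 <= rdot x x.
Proof. by apply: le_trans (sum_coord_le 0 x); rewrite /series/= big_geq. Qed.

Lemma coord_le x n t : normsq (x n t) <= rdot x x.
Proof.
apply: le_trans (sum_coord_le n.+1 x).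
rewrite /series/= big_nat_recr//= ler_wpDl//.
  by apply: sumr_ge0 => k _; exact: dotRe_ge0.
rewrite dotReE (bigD1 t)//= lerDl.
by apply: sumr_ge0 => s _; exact: normsq_ge0.
Qed.

Lemma l2dot_self x : l2dot x x = (rdot x x)%:C.
Proof.
rewrite /l2dot (_ : rdot x ('i%C *: x) = 0)//.
have := rdot_il x x; rewrite rdotC => /eqP.
by rewrite -addr_eq0 -mulr2n mulrn_eq0 => /eqP.
Qed.

Lemma l2dot_gt0 x : x != 0 -> 0 < l2dot x x.
Proof.
move=> x0; rewrite l2dot_self ltcR lt_neqAle rdot_ge0 andbT.
apply: contra x0 => /eqP x0; apply/eqP/l2_eqP => n t.
by apply: normsq_eq0; rewrite x0 coord_le.
Qed.

HB.instance Definition _ := isBilinear.Build R[i] (l2 R T) (l2 R T) R[i]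
  ( *%R) ((@Num.conj R[i]) \; *%R) l2dot l2dot_zmodl l2dot_zmodr
  l2dotZl l2dotZr.
HB.instance Definition _ :=
  isHermitianSesquilinear.Build R[i] (l2 R T) false (@Num.conj R[i])
    l2dot l2dotC.
HB.instance Definition _ :=
  isDotProduct.Build R[i] (l2 R T) l2dot l2dot_gt0.

Definition l2norm x : R[i] := sqrtC (l2dot x x).

Lemma l2normD x y : l2norm (x + y) <= l2norm x + l2norm y.
Proof. exact: dot_triangle. Qed.

Lemma l2normZ (a : R[i]) x : l2norm (a *: x) = `|a| * l2norm x.
Proof.
have n0 z := sqrt_dnorm_ge0 l2dot z.
apply/eqP; rewrite -(@eqrXn2 _ 2) ?mulr_ge0 ?n0//; apply/eqP.
by rewrite /l2norm exprMn !sqrtCK dnormZ.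
Qed.

Lemma l2norm_eq0 x : l2norm x = 0 -> x = 0.
Proof. by move=> /eqP; rewrite /l2norm sqrt_dnorm_eq0 => /eqP. Qed.

HB.instance Definition _ :=
  Lmodule_isNormed.Build R[i] (l2 R T) l2normD l2normZ l2norm_eq0.

Lemma sqr_norm_l2dot x : `|x| ^+ 2 = l2dot x x.
Proof. by rewrite /Num.norm/= /l2norm sqrtCK. Qed.

Lemma l2norm_le x (e : R) : 0 <= e -> (`|x| <= e%:C) = (rdot x x <= e ^+ 2).
Proof.
move=> e0; rewrite -(@ler_pXn2r _ 2)// ?nnegrE ?ler0c//.
by rewrite sqr_norm_l2dot l2dot_self -rmorphXn/= lecR.
Qed.

Lemma l2normE x : `|x| = (Num.sqrt (rdot x x))%:C.
Proof.
apply/eqP; rewrite -(@eqrXn2 _ 2)// ?ler0c ?sqrtr_ge0//.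
by rewrite sqr_norm_l2dot l2dot_self -rmorphXn/= sqr_sqrtr// rdot_ge0.
Qed.

End InnerProduct.

(** * Completeness *)

Section Completeness.
Variables (R : realType) (T : finType).
Local Notation H := (l2 R T).
Implicit Types (x y z : H).

Lemma norm_coord_le x n t : `|x n t| <= `|x|.
Proof.
rewrite -(@ler_pXn2r _ 2)// ?nnegrE//.
rewrite sqr_norm_l2dot l2dot_self -add_Re2_Im2 lecR; exact: coord_le.
Qed.

Lemma norm_Re_coord_le x n t : `|Re (x n t)|%:C <= `|x|.
Proof. exact: le_trans (normc_ge_Re _) (norm_coord_le _ _ _). Qed.

Lemma norm_Im_coord_le x n t : `|Im (x n t)|%:C <= `|x|.
Proof.
apply: le_trans (norm_coord_le x n t); rewrite -normrN -ReiNIm.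
by rewrite (le_trans (normc_ge_Re _))// normrM complexiE normCi mulr1.
Qed.

(** A Cauchy filter converges coordinatewise, since coordinates are
    nonexpansive. If all points of a set of the filter are within e of a point
    y of it, then every partial sum of the squared distance to y is at most
    e ^+ 2 along the filter, hence also at the coordinatewise limit f; so y - f
    is square-summable and within e of 0. *)
Lemma l2_complete (F : set_system H) : ProperFilter F -> cauchy F -> cvg F.
Proof.
move=> FF cF.
have small (e : R) : 0 < e -> exists2 A, F A &
    forall x y, A x -> A y -> `|x - y| <= e%:C.
  move=> e0; have e0C : (0 : R[i]) < e%:C by rewrite ltcR.
  have /cauchy_ballP/(_ _ e0C) := cF; case=> -[A B]/= [FA FB] AB.
  exists (A `&` B); first exact: filterI.
  move=> x y [Ax _] [_ By]; have := AB (x, y) (conj Ax By).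
  by rewrite /= -ball_normE /ball_/= => /ltW.
have lip (p : H -> R) : (forall x y, `|p x - p y|%:C <= `|x - y|) ->
    exists l : R, p @ F --> l.
  move=> lp; exists (lim (p @ F)); apply: R_complete; apply/cauchy_ballP => e e0.
  have [A FA Ae] := small _ (divr_gt0 e0 (ltr0n _ 2)).
  exists (p @` A, p @` A) => /=.
    by split; apply: (@filterS _ F _ A) => // x Ax; exists x.
  move=> [_ _] /= [[x Ax <-] [y Ay <-]]; rewrite -ball_normE /ball_/=.
  have := le_trans (lp x y) (Ae _ _ Ax Ay); rewrite lecR => /le_lt_trans; apply.
  by rewrite ltr_pdivrMr// ltr_pMr// ltr1n.
have reP n t : exists l : R, (fun x : H => Re (x n t)) @ F --> l.
  apply: lip => x y; apply: le_trans (norm_Re_coord_le (x - y) n t).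
  rewrite -[(x - y) n t]/(x n t - y n t).
  by case: (x n t) => ? ?; case: (y n t) => ? ?.
have imP n t : exists l : R, (fun x : H => Im (x n t)) @ F --> l.
  apply: lip => x y; apply: le_trans (norm_Im_coord_le (x - y) n t).
  rewrite -[(x - y) n t]/(x n t - y n t).
  by case: (x n t) => ? ?; case: (y n t) => ? ?.
pose f n t : R[i] := projT1 (cid (reP n t)) +i* projT1 (cid (imP n t)).
have fRe n t : (fun x : H => Re (x n t)) @ F --> Re (f n t).
  by rewrite /f/=; case: cid.
have fIm n t : (fun x : H => Im (x n t)) @ F --> Im (f n t).
  by rewrite /f/=; case: cid.
have close e A y N : 0 < e -> F A ->
    (forall x y, A x -> A y -> `|x - y| <= e%:C) -> A y ->
    series (dotRe (l2val y - f) (l2val y - f)) N <= e ^+ 2.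
  move=> e0 FA Ae Ay.
  have ReB (a b : R[i]) : Re (a - b) = Re a - Re b by case: a b => [? ?] [].
  have ImB (a b : R[i]) : Im (a - b) = Im a - Im b by case: a b => [? ?] [].
  have cRe n t : (fun x : H => Re (l2val (y - x) n t)) @ F -->
      Re ((l2val y - f) n t).
    rewrite (_ : (fun _ => _) = fun x : H => Re (y n t) - Re (x n t)); last first.
      by apply/funext => x; exact: ReB.
    by rewrite (ReB (y n t)); apply: cvgB => //; exact: cvg_cst.
  have cIm n t : (fun x : H => Im (l2val (y - x) n t)) @ F -->
      Im ((l2val y - f) n t).
    rewrite (_ : (fun _ => _) = fun x : H => Im (y n t) - Im (x n t)); last first.
      by apply/funext => x; exact: ImB.
    by rewrite (ImB (y n t)); apply: cvgB => //; exact: cvg_cst.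
  apply: (@cvgr_to_le _ F FF _
    (fun x => series (dotRe (l2val (y - x)) (l2val (y - x))) N)).
    have cs : continuous (fun z : R * R => z.1 + z.2).
      by move=> z; apply: cvgD; [exact: cvg_fst|exact: cvg_snd].
    rewrite /series/=; apply: (cvg_big cs) => n _; apply: (cvg_big cs) => t _.
    by apply: cvgD; apply: cvgM; (exact: cRe || exact: cIm).
  apply: filterS FA => x Ax; apply: le_trans (sum_coord_le N (y - x)) _.
  by rewrite -l2norm_le ?(ltW e0)// Ae.
have sf : f \in @sqsummable_pred R T.
  have [A FA Ae] := small _ ltr01.
  have [y Ay] := filter_ex FA.
  have yf : sqsummable (l2val y - f).
    by apply: sqsummable_bounded => N; exact: close ltr01 FA Ae Ay.
  apply/asboolP; rewrite -(subKr (l2val y) f) -[- (_ - _)]scaleN1r addrC.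
  by apply: sqsummableD => //; exact: sqsummable_l2.
apply/cvg_ex; exists (L2 sf); apply/cvgrPdistC_le => e /gt0_complexE[-> e0].
have [A FA Ae] := small _ e0.
apply: (filterS _ FA) => y Ay; rewrite l2norm_le ?(ltW e0)//.
apply: limr_le; first by apply: cvg_dotRe; exact: sqsummable_l2.
by apply: nearW => N; exact: close e0 FA Ae Ay.
Qed.

HB.instance Definition _ := Uniform_isComplete.Build H l2_complete.

HB.instance Definition _ :=
  CompleteNormedModule_isHilbert.Build R H (@sqr_norm_l2dot R T).

End Completeness.

(** * Adjoints of bounded operators *)

Lemma le0_eps (R : realFieldType) (r K : R) : 0 <= K ->
  (forall e, 0 < e -> r <= K * e) -> r <= 0.
Proof.
move=> K0 rK; apply/ler_addgt0Pl => e e0; rewrite addr0.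
have K1 : 0 < K + 1 by rewrite ltr_wpDl.
apply: le_trans (rK _ (divr_gt0 e0 K1)) _.
by rewrite mulrA ler_pdivrMr// mulrC ler_pM2l// lerDl.
Qed.

Section HilbertSpace.
Variables (R : realType) (H : hilbertType R).
Implicit Types (x y z : H).

Lemma inner_CauchySchwarz x y : `|inner x y| <= `|x| * `|y|.
Proof.
rewrite -(@ler_pXn2r _ 2)// ?nnegrE ?mulr_ge0//.
by rewrite exprMn !sqr_norm_inner dot_CauchySchwarz.
Qed.

Lemma innerC x y : inner x y = Num.conj (inner y x).
Proof. by rewrite hermC/= mul1r. Qed.

Lemma inner_inj y z : (forall x, inner x y = inner x z) -> y = z.
Proof.
move=> yz; apply/eqP; rewrite -subr_eq0 -(@dnorm_eq0 _ _ inner).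
by rewrite linearBr/= yz subrr.
Qed.

Lemma densityP (A : set H) :
  (forall x (e : R), 0 < e -> exists2 y, A y & `|x - y| <= e%:C) -> dense A.
Proof.
move=> dA O [x Ox] oO; have /nbhs_ballP[d d0 dO] := open_nbhs_nbhs (conj oO Ox).
have [dE d0'] := gt0_complexE d0.
have [y Ay xy] := dA x (Re d / 2) (divr_gt0 d0' (ltr0n _ 2)).
exists y; split => //; apply: dO; rewrite -ball_normE /ball_/= dE.
by apply: le_lt_trans xy _; rewrite ltcR ltr_pdivrMr// ltr_pMr// ltr1n.
Qed.

End HilbertSpace.

Section FiniteSupport.
Variables (R : realType) (T : finType).
Local Notation H := (l2 R T).
Implicit Types (x y z : H).

Lemma cvg_series_fin (u : nat -> R) N : (forall n, (N <= n)%N -> u n = 0) ->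
  series u @ \oo --> series u N.
Proof.
move=> u0; apply: cvg_near_cst; exists N => // n /= Nn.
rewrite /series/= (@big_cat_nat _ _ _ N)//=.
rewrite [X in _ + X](_ : _ = 0) ?addr0// big_nat big1// => k /andP[Nk _].
exact: u0.
Qed.

Lemma sqsummable_fin (f : nat -> T -> R[i]) N :
  (forall n t, (N <= n)%N -> f n t = 0) -> f \in @sqsummable_pred R T.
Proof.
move=> f0; apply/asboolP; apply/cvg_ex; eexists; apply: (@cvg_series_fin _ N).
by move=> n Nn; rewrite /dotRe big1// => t _; rewrite f0//= !mulr0 addr0.
Qed.

Lemma rdot_fin x y N : (forall n t, (N <= n)%N -> x n t = 0) ->
  rdot x y = series (dotRe x y) N.
Proof.
move=> x0; apply: cvg_lim => //; apply: cvg_series_fin => n Nn.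
by rewrite /dotRe big1// => t _; rewrite x0//= !mul0r addr0.
Qed.

Definition trunc_fun N (f : nat -> T -> R[i]) n t :=
  if (n < N)%N then f n t else 0.

Lemma trunc_subproof N f : trunc_fun N f \in @sqsummable_pred R T.
Proof.
by apply: (@sqsummable_fin _ N) => n t; rewrite /trunc_fun leqNgt => /negbTE ->.
Qed.

Definition trunc N f : H := L2 (trunc_subproof N f).

(** The squared distance from [x] to its truncation is the remainder of the
    series of [rdot x x]. *)
Lemma trunc_near x (e : R) : 0 < e ->
  exists N, `|x - trunc N x| <= e%:C.
Proof.
move=> e0; have xx := @cvg_rdot _ _ x x.
have e20 : 0 < e ^+ 2 by rewrite exprn_gt0.
have /cvgrPdist_le/(_ _ e20)[N _ /(_ N (leqnn N))] := xx.
rewrite ger0_norm ?subr_ge0 ?sum_coord_le// => xN.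
exists N; rewrite l2norm_le ?(ltW e0)//; apply: le_trans xN.
have -> : rdot (x - trunc N x) (x - trunc N x) =
    1 * rdot x x + (-1) * rdot (trunc N x) (trunc N x).
  apply: rdot_lin => n t; rewrite -[(x - _) n t]/(x n t - trunc_fun N x n t).
  rewrite -[l2val (trunc _ _) n t]/(trunc_fun N x n t) /trunc_fun.
  by case: ifPn => _; case: (x n t) => ? ? /=; ring.
rewrite (@rdot_fin (trunc N x) _ N); last first.
  by move=> n t; rewrite /= /trunc_fun leqNgt => /negbTE ->.
rewrite mul1r mulN1r lerD2l lerN2 /series/=.
rewrite le_eqVlt; apply/orP; left; apply/eqP.
apply: eq_big_nat => n /andP[_ nN]; apply: eq_bigr => t _.
by rewrite /= /trunc_fun nN.
Qed.

Lemma delta_subproof n t :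
  (fun m s => ((m == n) && (s == t))%:R : R[i]) \in @sqsummable_pred R T.
Proof.
by apply: (@sqsummable_fin _ n.+1) => m s nm; rewrite gtn_eqF.
Qed.

Definition delta n t : H := L2 (delta_subproof n t).

Lemma rdot_delta n t y : rdot (delta n t) y = Re (y n t).
Proof.
rewrite (@rdot_fin _ _ n.+1); last by move=> m s nm; rewrite /= gtn_eqF.
rewrite /series/= big_nat_recr//= big_nat big1 ?add0r; last first.
  move=> m /andP[_ mn]; rewrite /dotRe big1// => s _.
  by rewrite /= ltn_eqF//= !mul0r addr0.
rewrite /dotRe (bigD1 t)//= big1 => [|s st].
  by rewrite !eqxx/= mul1r mul0r !addr0.
by rewrite (negbTE st) andbF/= !mul0r addr0.
Qed.

Lemma inner_delta y n t : inner y (delta n t) = y n t.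
Proof.
rewrite -[LHS]/(rdot y (delta n t) +i* rdot y ('i%C *: delta n t)).
rewrite ![rdot y _]rdotC rdot_il !rdot_delta.
rewrite -[('i%C *: y) n t]/('i%C * y n t).
by case: (y n t) => a b /=; congr (_ +i* _); ring.
Qed.

Lemma inner_delta_l y n t : inner (delta n t) y = Num.conj (y n t).
Proof. by rewrite innerC inner_delta. Qed.

Lemma l2val_sum (I : Type) (r : seq I) (P : pred I) (F : I -> H) n t :
  l2val (\sum_(i <- r | P i) F i) n t = \sum_(i <- r | P i) F i n t.
Proof. by elim/big_rec2: _ => // i a b _ <-. Qed.

Lemma fin_sum x N : (forall n t, (N <= n)%N -> x n t = 0) ->
  x = \sum_(0 <= n < N) \sum_t x n t *: delta n t.
Proof.
move=> x0; apply: l2_eqP => m s; rewrite l2val_sum.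
under eq_bigr do rewrite l2val_sum.
have E n : \sum_t l2val (x n t *: delta n t) m s = if n == m then x n s else 0.
  transitivity (\sum_t x n t * ((m == n) && (s == t))%:R); first exact: eq_bigr.
  rewrite (bigD1 s)//= big1 => [|t ts].
    by rewrite addr0 eqxx andbT eq_sym; case: eqP; rewrite ?mulr1 ?mulr0.
  by rewrite [s == t]eq_sym (negbTE ts) andbF mulr0.
under eq_bigr do rewrite E.
rewrite -big_mkcond/=; have [Nm|mN] := leqP N m.
  rewrite x0// big_nat_cond big_pred0// => n.
  by apply/negbTE/negP => /andP[/andP[_ nN] /eqP nm]; rewrite nm ltnNge Nm in nN.
by rewrite big_nat1_eq mN.
Qed.

Lemma inner_fin (V : {linear H -> H}) x y N :
  (forall n t, (N <= n)%N -> x n t = 0) ->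
  inner (V x) y = \sum_(0 <= n < N) \sum_t x n t * inner (V (delta n t)) y.
Proof.
move=> x0; rewrite {1}(fin_sum x0).
rewrite linear_sum linear_sumlz/=; apply: eq_bigr => n _.
rewrite linear_sum linear_sumlz/=; apply: eq_bigr => t _.
by rewrite linearZ/= linearZl_LR.
Qed.

(** The coordinates of the adjoint at y must be c = <y, V e> for e in the
    canonical basis. They are square-summable: for the truncation u of c, the
    number <V u, y> is the partial sum S of the squares of c, while it is at
    most M |u| |y| = M |y| sqrt S. The two sides of the adjunction agree on
    truncations, and both are continuous. *)
Lemma adjoint_exists (V : {linear H -> H}) (M : R) : 0 <= M ->
  (forall x, `|V x| <= M%:C * `|x|) ->
  exists W : H -> H, forall x y, inner (V x) y = inner x (W y).
Proof.
move=> M0 VM.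
suff ex y : exists w, forall x, inner (V x) y = inner x w.
  by exists (fun y => projT1 (cid (ex y))) => x y; case: cid.
pose c n t := inner y (V (delta n t)).
have bnd x : `|inner (V x) y| <= M%:C * `|y| * `|x|.
  apply: le_trans (inner_CauchySchwarz _ _) _.
  by rewrite mulrAC; apply: ler_wpM2r => //; exact: VM.
have cP : c \in @sqsummable_pred R T.
  pose K := Num.sqrt (rdot y y); have K0 : 0 <= K by exact: sqrtr_ge0.
  have yK : `|y| = K%:C by exact: l2normE.
  apply/asboolP/(@sqsummable_bounded _ _ _ ((M * K) ^+ 2)) => N.
  have u0 n t : (N <= n)%N -> l2val (trunc N c) n t = 0.
    by move=> Nn; rewrite /= /trunc_fun ltnNge Nn.
  set S := series _ N.
  have uu : rdot (trunc N c) (trunc N c) = S.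
    rewrite (rdot_fin _ u0); apply: eq_big_nat => n /andP[_ nN].
    by apply: eq_bigr => t _; rewrite /= /trunc_fun nN.
  have S0 : 0 <= S by apply: sumr_ge0 => n _; exact: dotRe_ge0.
  have Vu : inner (V (trunc N c)) y = S%:C.
    rewrite (inner_fin _ _ u0) /S /series/= rmorph_sum/=.
    apply: eq_big_nat => n /andP[_ nN]; rewrite /dotRe rmorph_sum/=.
    apply: eq_bigr => t _; rewrite /trunc_fun nN innerC -/(c n t).
    rewrite -[rdot y (V (delta n t))]/(Re (c n t)).
    rewrite -[rdot y ('i%C *: V (delta n t))]/(Im (c n t)).
    case: (c n t) => a b; apply/eqP; rewrite eq_complex/=.
    by apply/andP; split; apply/eqP; ring.
  have := bnd (trunc N c).
  rewrite Vu normc_def/= expr0n addr0 sqrtr_sqr ger0_norm//.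
  rewrite [X in _ <= _ * X]l2normE uu yK -!rmorphM/= lecR.
  have [->|Sn0] := eqVneq S 0; first by rewrite sqr_ge0.
  have sS : 0 < Num.sqrt S by rewrite sqrtr_gt0 lt_neqAle eq_sym Sn0.
  rewrite -{1}(sqr_sqrtr S0) expr2 ler_pM2r// => le.
  rewrite -(sqr_sqrtr S0) ler_pXn2r// ?nnegrE ?sqrtr_ge0//.
  exact: le_trans (sqrtr_ge0 S) le.
exists (L2 cP) => x; apply/eqP; rewrite -subr_eq0 -normr_le0.
pose K := M%:C * `|y| + `|L2 cP|.
have K0 : 0 <= K by rewrite addr_ge0// mulr_ge0// ler0c.
have ReK : K = (Re K)%:C by rewrite RRe_real// ger0_real.
have ReK0 : 0 <= Re K by rewrite -ler0c -ReK.
have le (e : R) : 0 < e -> `|inner (V x) y - inner x (L2 cP)| <= K * e%:C.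
  move=> /(trunc_near x)[N xN].
  have x0 n t : (N <= n)%N -> l2val (trunc N x) n t = 0.
    by move=> Nn; rewrite /= /trunc_fun ltnNge Nn.
  have E : inner (V (trunc N x)) y = inner (trunc N x) (L2 cP).
    rewrite (inner_fin _ _ x0) -[trunc N x]/(idfun (trunc N x)).
    rewrite (inner_fin _ _ x0); apply: eq_bigr => n _; apply: eq_bigr => t _.
    by congr (_ * _); rewrite /= inner_delta_l innerC.
  have -> : inner (V x) y - inner x (L2 cP) =
      inner (V (x - trunc N x)) y - inner (x - trunc N x) (L2 cP).
    by rewrite linearB/= !linearBl/= E opprB addrA subrK.
  apply: le_trans (ler_normB _ _) _; rewrite mulrDl; apply: lerD.
    apply: le_trans (bnd _) _; apply: ler_wpM2l => //.
    by rewrite mulr_ge0// ler0c.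
  by apply: le_trans (inner_CauchySchwarz _ _) _; rewrite mulrC ler_wpM2l.
have [r rE] : exists r : R, `|inner (V x) y - inner x (L2 cP)| = r%:C.
  by eexists; rewrite normc_def.
rewrite rE -[0]/(0%:C) lecR; apply: (@le0_eps _ _ (Re K)) => // e e0.
by rewrite -lecR rmorphM/= -ReK -rE; exact: le.
Qed.

End FiniteSupport.

(** * Congruence of self-adjoint operators *)

Section Conjugation.
Variables (R : realType) (H : hilbertType R).

Lemma adjoint_linear (V W : H -> H) :
  (forall x y, inner (V x) y = inner x (W y)) ->
  forall (a : R[i]) y z, W (a *: y + z) = a *: W y + W z.
Proof.
move=> VW a y z; apply: inner_inj => x.
by rewrite -VW !linearDr/= !linearZr_LR/= !VW.
Qed.

(** Adjunction reverses composition, so the adjoint of a left inverse is a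
    right inverse of the adjoint. *)
Lemma adjointK (V V' W W' : H -> H) :
  (forall x y, inner (V x) y = inner x (W y)) ->
  (forall x y, inner (V' x) y = inner x (W' y)) ->
  cancel V V' -> cancel W' W.
Proof. by move=> VW VW' VK y; apply: inner_inj => x; rewrite -VW -VW' VK. Qed.

Lemma dense_approx (A : set H) x (e : R) : dense A -> 0 < e ->
  exists2 y, A y & `|x - y| <= e%:C.
Proof.
move=> dA e0; have e0C : (0 : R[i]) < e%:C by rewrite ltcR.
have [] := dA (ball x e%:C); first by exists x; exact: ballxx.
  exact: ball_open.
by move=> y [+ Ay]; rewrite -ball_normE /ball_/= => /ltW xy; exists y.
Qed.

Section ConjOp.
Variables (T : operator H) (L : {linear H -> H}) (W : H -> H).
Hypothesis LW : forall x y, inner (L x) y = inner x (W y).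

Definition conj_dom : set H := [set x | op_dom T (L x)].
Definition conj_fun (x : H) : H := W (T (L x)).

Lemma conj_dom0 : conj_dom 0.
Proof. by rewrite /conj_dom/= linear0; exact: op_dom0. Qed.

Lemma conj_domP (a : R[i]) x y :
  conj_dom x -> conj_dom y -> conj_dom (a *: x + y).
Proof. by rewrite /conj_dom/= linearP => ? ?; exact: op_domP. Qed.

Lemma conj_linear (a : R[i]) x y : conj_dom x -> conj_dom y ->
  conj_fun (a *: x + y) = a *: conj_fun x + conj_fun y.
Proof.
by move=> xd yd; rewrite /conj_fun linearP op_linear// (adjoint_linear LW).
Qed.

(** This is the congruence L^* T L of T, where W is the adjoint L^* of L. *)
Definition conj_op : operator H :=
  Operator conj_dom0 conj_domP conj_linear.

(** If z = (L^* T L)^* y, then substituting x = L^-1 u turns the relation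
    <L^* T L x, y> = <x, z> into <T u, L y> = <u, (L^-1)^* z> for all u in the
    domain of T. As T is self-adjoint, L y is in its domain and
    T L y = (L^-1)^* z, that is L^* T L y = z. The domain of L^* T L is the
    image of that of T by the continuous bijection L^-1, hence dense. *)
Lemma conj_self_adjoint (Li Wi : H -> H) (M : R) :
  (forall x y, inner (Li x) y = inner x (Wi y)) ->
  cancel L Li -> cancel Li L -> 0 <= M ->
  (forall x y, `|Li x - Li y| <= M%:C * `|x - y|) ->
  self_adjoint T -> self_adjoint conj_op.
Proof.
move=> LWi LK LiK M0 LiM [dT gT]; split.
  apply: densityP => x e e0; have M1 : 0 < M + 1 by rewrite ltr_wpDl.
  have [z Tz Lxz] := dense_approx (L x) dT (divr_gt0 e0 M1).
  exists (Li z); first by rewrite /= /conj_dom/= LiK.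
  rewrite -{1}(LK x); apply: le_trans (LiM _ _) _.
  apply: le_trans (ler_wpM2l _ Lxz) _; first by rewrite ler0c.
  rewrite -rmorphM/= lecR mulrA ler_pdivrMr// mulrC ler_pM2l//.
  by rewrite lerDl.
apply/seteqP; split=> -[y z] /=.
- case=> /= Ty -> x Tx; rewrite /conj_fun -LW innerC -LW -innerC.
  have : graph T (L y, T (L y)) by [].
  by rewrite gT => /(_ _ Tx).
- move=> yz; have : adjoint_graph T (L y, Wi z).
    move=> u Tu /=; have := yz (Li u).
    rewrite /= /conj_dom/= /conj_fun LiK => /(_ Tu).
    by rewrite LWi innerC -LW -innerC.
  rewrite -gT => -[/= Ty zE]; split => //=.
  by rewrite /conj_fun -zE (adjointK LW LWi).
Qed.

End ConjOp.
End Conjugation.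

(** * Weighted involutions *)

Section WeightedInvolution.
Variables (R : realType) (T : finType).
Local Notation H := (l2 R T).
Implicit Types (x y z : H).

(** Families that are not square-summable are sent to 0, so that an operator
    can be given by a formula on its maximal domain. *)
Definition mkl2 (f : nat -> T -> R[i]) : H :=
  if pselect (f \in @sqsummable_pred R T) is left fP then L2 fP else 0.

Lemma mkl2E f n t : sqsummable f -> mkl2 f n t = f n t.
Proof. by move=> /asboolP sf; rewrite /mkl2; case: pselect. Qed.

Variables (w : nat -> T -> R) (sg : T -> T).

Definition wfun (f : nat -> T -> R[i]) n t : R[i] := (w n t)%:C * f n (sg t).

Definition wdom : set H := [set x | sqsummable (wfun x)].

Lemma wfunP (a : R[i]) x y : wfun (a *: x + y) = a *: wfun x + wfun y.
Proof.
apply/funext => n; apply/funext => t; rewrite /wfun.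
rewrite -[(a *: x + y) n (sg t)]/(a * x n (sg t) + y n (sg t)).
rewrite -[RHS]/(a * ((w n t)%:C * x n (sg t)) + (w n t)%:C * y n (sg t)).
by rewrite mulrDr mulrCA.
Qed.

Lemma wdom0 : wdom 0.
Proof.
rewrite /wdom/= (_ : wfun _ = 0); first exact: sqsummable0.
by apply/funext => n; apply/funext => t; rewrite /wfun mulr0.
Qed.

Lemma wdomP (a : R[i]) x y : wdom x -> wdom y -> wdom (a *: x + y).
Proof. by move=> ? ?; rewrite /wdom/= wfunP; exact: sqsummableD. Qed.

Lemma wlinear (a : R[i]) x y : wdom x -> wdom y ->
  mkl2 (wfun (a *: x + y)) = a *: mkl2 (wfun x) + mkl2 (wfun y).
Proof.
move=> xd yd; apply: l2_eqP => n t.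
rewrite mkl2E; last exact: wdomP.
rewrite -[RHS]/(a * mkl2 (wfun x) n t + mkl2 (wfun y) n t) !mkl2E//.
by rewrite wfunP.
Qed.

Definition wop : operator H :=
  @Operator _ _ wdom (fun x => mkl2 (wfun x)) wdom0 wdomP wlinear.

Lemma wopE x n t : wdom x -> wop x n t = (w n t)%:C * x n (sg t).
Proof. by move=> xd; rewrite /= mkl2E. Qed.

Hypothesis sgK : involutive sg.
Hypothesis wsg : forall n t, w n (sg t) = w n t.

Lemma wdom_trunc N x : wdom (trunc N x).
Proof.
apply/asboolP; apply: (@sqsummable_fin _ _ _ N) => n t Nn.
by rewrite /wfun /= /trunc_fun ltnNge Nn mulr0.
Qed.

Lemma wdom_delta n t : wdom (delta R n t).
Proof.
apply/asboolP; apply: (@sqsummable_fin _ _ _ n.+1) => m s nm.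
by rewrite /wfun /= gtn_eqF// mulr0.
Qed.

Lemma wop_delta n t : wop (delta R n t) = (w n t)%:C *: delta R n (sg t).
Proof.
apply: l2_eqP => m s; rewrite wopE; last exact: wdom_delta.
rewrite -[RHS]/((w n t)%:C * ((m == n) && (s == sg t))%:R).
rewrite -[delta _ _ _ _ _]/(((m == n) && (sg s == t))%:R).
have -> : (sg s == t) = (s == sg t) by rewrite -(inj_eq (inv_inj sgK)) sgK.
case: eqP => [->|]; last by rewrite !mulr0.
by case: eqP => [->|]; rewrite ?wsg// !mulr0.
Qed.

Lemma wop_sym x y : wdom x -> wdom y -> inner (wop x) y = inner x (wop y).
Proof.
move=> xd yd.
have sym z : wdom z -> rdot (wop x) z = rdot x (wop z).
  move=> zd; rewrite /rdot; congr (limn (series _)).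
  apply/funext => n; rewrite /dotRe [RHS](reindex_inj (inv_inj sgK)).
  apply: eq_bigr => t _; rewrite !wopE// sgK wsg.
  by case: (x n _) (z n _) => [? ?] [? ?] /=; ring.
rewrite -[LHS]/(rdot (wop x) y +i* rdot (wop x) ('i%C *: y)).
rewrite -[RHS]/(rdot x (wop y) +i* rdot x ('i%C *: wop y)).
congr (_ +i* _); first exact: sym.
have iyd : wdom ('i%C *: y).
  by rewrite -[_ *: _]addr0; apply: wdomP => //; exact: wdom0.
rewrite sym//; congr (rdot x _); apply: l2_eqP => n t; rewrite wopE//.
rewrite -[RHS]/('i%C * wop y n t) wopE//.
by rewrite -[('i%C *: y) n _]/('i%C * y n (sg t)) mulrCA.
Qed.

(** Symmetry is a termwise reindexing by the involution. Conversely, testing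
    the defining relation of the adjoint at (y, z) on the canonical basis shows
    that z is given by the formula at y; in particular the formula at y is
    square-summable, so y is in the maximal domain. *)
Lemma wop_self_adjoint : self_adjoint wop.
Proof.
split.
  apply: densityP => x e /(trunc_near x)[N xN].
  by exists (trunc N x) => //; exact: wdom_trunc.
apply/seteqP; split=> -[y z].
  by case=> /= yd -> x xd; exact: wop_sym.
move=> yz.
have E n t : z n t = wfun y n t.
  have := yz _ (@wdom_delta n t); rewrite /= -[mkl2 _]/(wop (delta R n t)).
  rewrite wop_delta linearZl_LR/= !inner_delta_l.
  move=> /(congr1 (@Num.conj _)); rewrite rmorphM/= !conjCK => <-.
  by rewrite /wfun conj_Creal// complex_real.
have wE : wfun y = z by apply/funext => n; apply/funext => t; rewrite E.
have yd : wdom y by rewrite /wdom/= wE; exact: sqsummable_l2.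
by split => //=; apply: l2_eqP => n t; rewrite mkl2E.
Qed.

End WeightedInvolution.

(** * Comparison of square-summable families *)

Section Comparison.
Variables (R : realType) (T : finType).
Local Notation H := (l2 R T).

Lemma sqsummable_cmp (f g : nat -> T -> R[i]) (K : R) (sg : T -> T) :
  injective sg -> (forall n t, normsq (f n t) <= K * normsq (g n (sg t))) ->
  sqsummable g -> sqsummable f.
Proof.
move=> sgI fg sg'; apply: (@sqsummable_le _ _ _ (K *: dotRe g g)).
  move=> n; rewrite -[leRHS]/(K * dotRe g g n) !dotReE.
  rewrite [X in _ <= _ * X](reindex_inj sgI) mulr_sumr.
  by apply: ler_sum => t _; exact: fg.
exact: is_cvg_seriesZ.
Qed.

Lemma sqsummable_cmp2 (f g h : nat -> T -> R[i]) :
  (forall n t, normsq (f n t) <= normsq (g n t) + normsq (h n t)) ->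
  sqsummable g -> sqsummable h -> sqsummable f.
Proof.
move=> fg sg sh; apply: (@sqsummable_le _ _ _ (dotRe g g + dotRe h h)).
  move=> n; rewrite -[leRHS]/(dotRe g g n + dotRe h h n) !dotReE -big_split.
  by apply: ler_sum => t _; exact: fg.
exact: is_cvg_seriesD.
Qed.

Lemma rdot_disjoint (x y : H) : (forall n t, x n t = 0 \/ y n t = 0) ->
  rdot x y = 0.
Proof.
move=> xy; rewrite (@rdot_lin _ _ 0 0 x y x y x y) ?mul0r ?addr0// => n t.
by rewrite !mul0r addr0; case: (xy n t) => ->; rewrite /= ?mul0r ?mulr0 addr0.
Qed.

Lemma inner_disjoint (x y : H) : (forall n t, x n t = 0 \/ y n t = 0) ->
  inner x y = 0.
Proof.
move=> xy; rewrite -[LHS]/(rdot x y +i* rdot x ('i%C *: y)).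
rewrite !rdot_disjoint// => n t; have [->|y0] := xy n t; [by left|right].
by rewrite -[LHS]/('i%C * y n t) y0 mulr0.
Qed.

(** A square-summable family tends to 0, so a value taken infinitely often by
    one of its coordinates is 0. *)
Lemma sqsummable_cst (f : nat -> T -> R[i]) (z : R[i]) (t : T) (k : nat -> nat) :
  sqsummable f -> (forall N, (N <= k N)%N) -> (forall N, f (k N) t = z) ->
  z = 0.
Proof.
move=> sf kN fz; apply: normsq_eq0; apply/ler_addgt0Pl => e e0.
rewrite addr0; have /cvgrPdist_le/(_ _ e0)[N _ Ne] := cvg_series_cvg_0 sf.
have := Ne (k N) (kN N); rewrite sub0r normrN => /(le_trans _); apply.
apply: le_trans (ler_norm _); rewrite dotReE (bigD1 t)//= fz lerDl.
by apply: sumr_ge0 => s _; exact: normsq_ge0.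
Qed.

End Comparison.

(** * Nilpotent operators and shears *)

Section Shear.
Variables (R : realType).
Local Notation T := (bool * bool)%type.
Local Notation H := (l2 R T).
Implicit Types (x y z : H) (b k : bool).

Definition nilp_fun b (f : nat -> T -> R[i]) n (t : T) : R[i] :=
  if t.1 && (t.2 == b) then (2 ^- n)%:C * f (logn 2 n) (true, ~~ b) else 0.

Lemma nilp_fun_le b x n :
  dotRe (nilp_fun b x) (nilp_fun b x) n <= geometric (4 * rdot x x) (2^-1) n.
Proof.
rewrite dotReE; apply: le_trans (_ : \sum_(t : T) 2^-1 ^+ n * rdot x x <= _).
  apply: ler_sum => t _; rewrite /nilp_fun; case: ifP => _; last first.
    by rewrite /normsq/= expr0n addr0 mulr_ge0 ?exprn_ge0 ?invr_ge0 ?rdot_ge0.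
  rewrite normsqM normsq_real; apply: ler_pM; rewrite ?sqr_ge0 ?normsq_ge0//.
    rewrite -exprVn -exprM; apply: ler_wiXn2l; rewrite ?invr_ge0//.
      by rewrite invf_le1// ler1n.
    by rewrite leq_pmulr.
  exact: coord_le.
rewrite sumr_const card_prod !card_bool /geometric/=.
rewrite -mulr_natl ?natrM le_eqVlt; apply/orP; left; apply/eqP.
by move: (_ ^+ n) => u; ring.
Qed.

Lemma half_lt1 : `|2^-1 : R| < 1.
Proof. by rewrite ger0_norm ?invr_ge0// invf_lt1// ltr1n. Qed.

Lemma nilp_fun_sqsummable b x : sqsummable (nilp_fun b x).
Proof.
apply: sqsummable_le (nilp_fun_le b x) _.
exact: is_cvg_geometric_series half_lt1.
Qed.

(** On the summand [true], this operator maps coordinate [~~ b] to coordinate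
    [b] and kills the rest, so its square is 0. The 2-adic valuation
    [logn 2 n] takes each value infinitely often, so that the weighted family
    2 ^ n * (nilp b x) n is square-summable only if coordinate [~~ b] of [x]
    vanishes: the range of this operator avoids the domain of the weight
    2 ^ n. *)
Definition nilp b x : H := mkl2 (nilp_fun b x).

Lemma nilpE b x n t : nilp b x n t =
  if t.1 && (t.2 == b) then (2 ^- n)%:C * x (logn 2 n) (true, ~~ b) else 0.
Proof. by rewrite mkl2E//; exact: nilp_fun_sqsummable. Qed.

Lemma nilp_linear b (a : R[i]) x y :
  nilp b (a *: x + y) = a *: nilp b x + nilp b y.
Proof.
apply: l2_eqP => n t.
rewrite -[RHS]/(a * nilp b x n t + nilp b y n t) !nilpE.
case: ifP => _; last by rewrite mulr0 addr0.
by rewrite mulrCA -mulrDr.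
Qed.

Lemma nilp_nilp b x : nilp b (nilp b x) = 0.
Proof.
apply: l2_eqP => n t; rewrite nilpE; case: ifP => // _.
by rewrite nilpE/=; case: b; rewrite /= mulr0.
Qed.

Lemma nilp_bounded b x : `|nilp b x| <= 3%:R%:C * `|x|.
Proof.
rewrite [X in _ <= _ * X]l2normE -rmorphM/= l2norm_le ?mulr_ge0 ?sqrtr_ge0//.
have x0 := rdot_ge0 x; rewrite exprMn sqr_sqrtr//.
have E : dotRe (nilp b x) (nilp b x) = dotRe (nilp_fun b x) (nilp_fun b x).
  by apply/funext => n; apply: eq_bigr => t _; rewrite nilpE.
apply: le_trans (_ : 4 * rdot x x / (1 - 2^-1) <= _).
  have G := @cvg_geometric_series _ (4 * rdot x x) _ half_lt1.
  rewrite /rdot E -(cvg_lim _ G)//.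
  apply: lim_series_le.
  - exact: nilp_fun_sqsummable.
  - exact: is_cvg_geometric_series half_lt1.
  - exact: nilp_fun_le.
rewrite (_ : (1 - 2^-1)^-1 = 2 :> R); last by field.
by rewrite mulrAC ler_wpM2r// -natrX -natrM ler_nat.
Qed.

(** The exponent [k] selects the sign, so that [shear b true] is the inverse of
    [shear b false]. *)
Definition shear b k x : H := x + (-1) ^+ k *: nilp b x.

Lemma shear_linear b k : linear (shear b k).
Proof.
move=> a x y; rewrite /shear nilp_linear scalerDr scalerA mulrC -scalerA.
by rewrite scalerDr addrACA.
Qed.

HB.instance Definition _ b k := GRing.isLinear.Build R[i] H H _ (shear b k)
  (@shear_linear b k).

Lemma shearE b k x n t : shear b k x n t = x n t + (-1) ^+ k * nilp b x n t.
Proof. by []. Qed.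

Lemma shearK b k : cancel (shear b k) (shear b (~~ k)).
Proof.
move=> x; rewrite {1}/shear /shear -[x in nilp b (x + _)]scale1r nilp_linear.
have nZ a y : nilp b (a *: y) = a *: nilp b y.
  have n0 : nilp b 0 = 0.
    by apply: l2_eqP => n t; rewrite nilpE mulr0; case: ifP.
  by rewrite -[_ *: _]addr0 nilp_linear n0 addr0.
rewrite scale1r nZ nilp_nilp scaler0 addr0 -addrA -scalerDl.
by case: k; rewrite expr0 expr1 ?addNr ?subrr scale0r addr0.
Qed.

Lemma shear_bounded b k x : `|shear b k x| <= 4%:R%:C * `|x|.
Proof.
apply: le_trans (ler_normD _ _) _.
rewrite normrZ normr_sign mul1r.
apply: le_trans (lerD (lexx _) (nilp_bounded b x)) _.
rewrite (_ : 4%:R%:C = 1 + 3%:R%:C :> R[i]); last first.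
  by rewrite -(rmorph1 (real_complex R)) -rmorphD nat1r.
by rewrite mulrDl mul1r lexx.
Qed.

End Shear.

(** * The straightening map *)

Section Straightening.
Variables (R : realType).
Local Notation T := (bool * bool)%type.
Local Notation H := (l2 R T).
Implicit Types (x y z : H) (b k : bool).

(** This describes the domain of D (x) 1, which is that of S and T1 on K, and of
    A on K + K. *)
Definition decay (f : nat -> T -> R[i]) :=
  sqsummable (fun n t => (2 ^+ n)%:C * f n t).

(** The weighted difference of [shear b false x] and [x] is a family that takes
    the value [x j (true, ~~ b)] at each of the infinitely many n of 2-adic
    valuation j; being square-summable, it forces this value to be 0. *)
Lemma shear_decay b x : decay x -> decay (shear b false x) ->
  forall j, x j (true, ~~ b) = 0.
Proof.
move=> dx dSx j.
(* The integers of 2-adic valuation j. *)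
pose k N := (2 ^ j * (2 * N).+1)%N.
pose f n (t : T) : R[i] :=
  if t.1 && (t.2 == b) then x (logn 2 n) (true, ~~ b) else 0.
have sf : sqsummable f.
  have := @sqsummableD _ _ (-1) _ _ dx dSx.
  congr (sqsummable _); apply/funext => n; apply/funext => t.
  rewrite -[LHS]/(-1 * ((2 ^+ n)%:C * x n t) + (2 ^+ n)%:C * shear b false x n t).
  rewrite shearE expr0 mul1r mulN1r mulrDr addKr nilpE /f.
  case: ifP => _; last by rewrite mulr0.
  rewrite mulrA -rmorphM/= divff ?expf_neq0// ?pnatr_eq0//.
  by rewrite rmorph1 mul1r.
apply: (sqsummable_cst sf (t := (true, b)) (k := k)) => N.
  rewrite /k (leq_trans (_ : N <= (2 * N).+1)%N) ?leq_pmull ?expn_gt0//.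
  by rewrite leqW// leq_pmull.
rewrite /f /= eqxx /k lognM ?expn_gt0// pfactorK// logn_coprime ?addn0//.
by rewrite coprime2n /= mul2n odd_double.
Qed.

(** One shear only forces one of the two coordinates of the summand [true] to
    vanish. Composing the two shears takes care of both, and still gives an
    explicitly invertible bounded map. *)
Definition straighten x : H := shear false false (shear true false x).
Definition unstraighten x : H := shear true true (shear false true x).

Lemma straighten_linear : linear straighten.
Proof. by move=> a x y; rewrite /straighten !linearP. Qed.

Lemma unstraighten_linear : linear unstraighten.
Proof. by move=> a x y; rewrite /unstraighten !linearP. Qed.

HB.instance Definition _ :=
  GRing.isLinear.Build R[i] H H _ straighten straighten_linear.
HB.instance Definition _ :=
  GRing.isLinear.Build R[i] H H _ unstraighten unstraighten_linear.

Lemma straightenK : cancel straighten unstraighten.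
Proof.
move=> x; rewrite /straighten /unstraighten.
rewrite -[shear false true _]/(shear false (~~ false) _) shearK.
exact: (@shearK _ true false).
Qed.

Lemma unstraightenK : cancel unstraighten straighten.
Proof.
move=> x; rewrite /straighten /unstraighten.
rewrite -[shear true false _]/(shear true (~~ true) _) shearK.
exact: (@shearK _ false true).
Qed.

Lemma straighten_bounded x : `|straighten x| <= 16%:R%:C * `|x|.
Proof.
apply: le_trans (shear_bounded _ _ _) _.
rewrite (_ : 16%:R = 4%:R * 4%:R :> R); last by rewrite -natrM.
by rewrite rmorphM/= -mulrA ler_wpM2l ?ler0c// shear_bounded.
Qed.

Lemma unstraighten_bounded x : `|unstraighten x| <= 16%:R%:C * `|x|.
Proof.
apply: le_trans (shear_bounded _ _ _) _.
rewrite (_ : 16%:R = 4%:R * 4%:R :> R); last by rewrite -natrM.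
by rewrite rmorphM/= -mulrA ler_wpM2l ?ler0c// shear_bounded.
Qed.

Lemma straightenE x n t : straighten x n t =
  shear true false x n t + nilp false (shear true false x) n t.
Proof. by rewrite /straighten shearE expr0 mul1r. Qed.

Definition first_summand x := forall n b, x n (true, b) = 0.

(** The product of the shears acts on the summand [true], which therefore
    carries a copy of the domain [decay] moved to a position where it meets
    [decay] only at 0. The intermediate vector y of the factorization also
    satisfies [decay], because each of its coordinates is one of [x] or of
    [straighten x]; this allows one to apply [shear_decay] to both factors. *)
Lemma straighten_decay x : decay x -> decay (straighten x) -> first_summand x.
Proof.
move=> dx dLx; pose y := shear true false x.
have yE n t : y n t = if t.1 && t.2 then straighten x n t else x n t.
  rewrite straightenE -/y nilpE.
  have [t12|t12] := boolP (t.1 && t.2).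
    by case: t t12 => -[] [] //= _; rewrite addr0.
  by rewrite /y shearE nilpE eqb_id (negbTE t12) mulr0 addr0.
have dy : decay y.
  apply: sqsummable_cmp2 dx dLx => n t; rewrite yE.
  by case: ifP => _; rewrite ?lerDl ?lerDr normsq_ge0.
have x0 j : x j (true, false) = 0 by exact: (shear_decay dx dy).
have y0 j : y j (true, true) = 0 by exact: (shear_decay dy dLx).
move=> n [|]; last exact: x0.
by have := y0 n; rewrite /y shearE nilpE /= x0 !mulr0 addr0.
Qed.

Lemma straighten_first x : first_summand x -> straighten x = x.
Proof.
move=> lx; have nx b : nilp b x = 0.
  by apply: l2_eqP => n t; rewrite nilpE lx mulr0; case: ifP.
have sx b : shear b false x = x by rewrite /shear nx scaler0 addr0.
by rewrite /straighten !sx.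
Qed.

Lemma straighten_false x n b : straighten x n (false, b) = x n (false, b).
Proof. by rewrite straightenE shearE !nilpE/= mulr0 !addr0. Qed.

Lemma inner_straighten_first x y :
  first_summand y -> inner (straighten x) y = inner x y.
Proof.
move=> ly; rewrite -[straighten x](subrK x) linearDl/= inner_disjoint ?add0r//.
move=> n [[] b]; first by right.
left; rewrite -[LHS]/(straighten x n (false, b) - x n (false, b)).
by rewrite straighten_false subrr.
Qed.

Lemma first_summand_delta n b : first_summand (delta R n (false, b)).
Proof. by move=> m c; rewrite /= andbF. Qed.

Section Adjoint.
Variable W : H -> H.
Hypothesis LW : forall x y, inner (straighten x) y = inner x (W y).

Lemma adj_first x : first_summand x -> W x = x.
Proof.
by move=> lx; apply: inner_inj => z; rewrite -LW inner_straighten_first.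
Qed.

Lemma adj_false x n b : W x n (false, b) = x n (false, b).
Proof.
rewrite -[LHS]inner_delta innerC -LW straighten_first; last first.
  exact: first_summand_delta.
by rewrite -innerC inner_delta.
Qed.

End Adjoint.

End Straightening.

(** * Closed and unbounded operators on l2 *)

Lemma nonexpansive_continuous (K : numFieldType) (V W : normedModType K)
  (f : V -> W) : (forall x y, `|f x - f y| <= `|x - y|) -> continuous f.
Proof.
move=> fle x; apply/cvgrPdist_le => e e0; near=> y.
apply: le_trans (fle x y) _.
by near: y; apply: cvgr_dist_le => //; exact: cvg_id.
Unshelve. all: by end_near. Qed.

Section Operators.
Variables (R : realType) (T : finType).
Local Notation H := (l2 R T).

Lemma op0 (S : operator H) : S 0 = 0.
Proof.
have := op_linear (-1) (op_dom0 S) (op_dom0 S).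
by rewrite scaler0 addr0 scaleN1r addNr.
Qed.

Lemma norm_delta n t : `|@delta R T n t| <= 1.
Proof.
rewrite -(rmorph1 (real_complex R)) l2norm_le// rdot_delta expr1n.
by rewrite /= !eqxx.
Qed.

Lemma unbounded_opP (S : operator H) (t u : nat -> T) :
  (forall n, op_dom S (@delta R T n (t n))) ->
  (forall n, (2 ^+ n)%:C <= `|S (@delta R T n (t n)) n (u n)|) ->
  unbounded_op S.
Proof.
move=> Sd S2 [M [M0 SM]].
have le n : 2 ^+ n <= M.
  rewrite -lecR; apply: le_trans (S2 n) _.
  apply: le_trans (norm_coord_le _ _ _) _.
  apply: le_trans (SM _ (Sd n)) _.
  by rewrite -[leRHS]mulr1 ler_wpM2l ?ler0c// norm_delta.
have := le (Num.bound M); rewrite leNgt => /negP; apply.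
apply: lt_le_trans (archi_boundP M0) _.
by rewrite -natrX ler_nat ltnW// ltn_expl.
Qed.

Lemma closed_forall (X : topologicalType) (I : Type) (F : I -> set X) :
  (forall i, closed (F i)) -> closed [set p | forall i, F i p].
Proof.
move=> cF; rewrite (_ : [set _ | _] = \bigcap_i F i).
  by apply: closed_bigI => i _; exact: cF.
by apply/seteqP; split => p /= Fp i; [move=> _|]; exact: Fp.
Qed.

Lemma coord_continuous n t : continuous (fun x : H => x n t : R[i]^o).
Proof.
by apply: nonexpansive_continuous => x y; exact: (norm_coord_le (x - y)).
Qed.

Lemma closed_coord (a c : R[i]) n t m s :
  closed [set p : H * H | c * p.2 n t = a * p.1 m s].
Proof.
pose E (p : H * H) : R[i]^o :=
  c *: (p.2 n t : R[i]^o) - a *: (p.1 m s : R[i]^o).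
have E_continuous : continuous E.
  move=> p; apply: cvgB; apply: cvgZ; try exact: cvg_cst.
    apply: (@cvg_comp _ _ _ snd (fun x : H => x n t : R[i]^o) _ (nbhs p.2)).
      exact: cvg_snd.
    exact: coord_continuous.
  apply: (@cvg_comp _ _ _ fst (fun x : H => x m s : R[i]^o) _ (nbhs p.1)).
    exact: cvg_fst.
  exact: coord_continuous.
rewrite (_ : [set _ | _] = E @^-1` [set 0]).
  apply: closed_comp => //.
  exact/accessible_closed_set1/hausdorff_accessible/norm_hausdorff.
apply/seteqP; split => p /=; first by move=> pE; apply/eqP; rewrite subr_eq0; apply/eqP.
by move/eqP; rewrite subr_eq0 => /eqP.
Qed.

End Operators.

(** * The operators and their commutators *)

Section Counterexample.
Variables (R : realType).
Local Notation T := (bool * bool)%type.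
Local Notation H := (l2 R T).
Implicit Types (x y z : H) (b k : bool).

Definition scale (t : T) : R := if t.2 then 2 else 1.
Definition weight n t : R := scale t * 2 ^+ n.
Definition flip_summand (t : T) : T := (~~ t.1, t.2).
Definition flip_coord (t : T) : T := (t.1, ~~ t.2).

Lemma flip_summandK : involutive flip_summand.
Proof. by case=> a b; rewrite /flip_summand /= negbK. Qed.

Lemma flip_coordK : involutive flip_coord.
Proof. by case=> a b; rewrite /flip_coord /= negbK. Qed.

Lemma pow2_gt0 n : 0 < 2 ^+ n :> R.
Proof. by rewrite exprn_gt0. Qed.

Lemma scale_bounds t : 1 <= scale t <= 2.
Proof. by rewrite /scale; case: ifP; rewrite ?lexx ?ler1n ?andbT. Qed.

Lemma normsq_mulr_le (a c : R) (z : R[i]) : 0 <= a -> a <= c ->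
  normsq (a%:C * z) <= normsq (c%:C * z).
Proof.
move=> a0 ac; rewrite !normsqM !normsq_real ler_wpM2r ?normsq_ge0//.
by rewrite ler_pXn2r// nnegrE// (le_trans a0).
Qed.

Lemma wdom_decay (w : nat -> T -> R) (sg : T -> T) x : involutive sg ->
  (forall n t, 2 ^+ n <= w n t <= 2 * 2 ^+ n) -> wdom w sg x <-> decay x.
Proof.
move=> sgK wb; split;
  apply: (@sqsummable_cmp _ _ _ _ 4 sg (inv_inj sgK)) => n t.
- rewrite /wfun sgK; have /andP[w1 _] := wb n (sg t).
  apply: le_trans (normsq_mulr_le _ (ltW (pow2_gt0 n)) w1) _.
  by rewrite ler_peMl ?normsq_ge0// ler1n.
- rewrite /wfun; have /andP[w1 w2] := wb n t.
  apply: le_trans (normsq_mulr_le _ (le_trans (ltW (pow2_gt0 n)) w1) w2) _.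
  by rewrite rmorphM/= -mulrA normsqM normsq_real (_ : 2 ^+ 2 = 4) // -natrX.
Qed.

Lemma weight_bounds n t : 2 ^+ n <= weight n t <= 2 * 2 ^+ n.
Proof.
have /andP[s1 s2] := scale_bounds t; have p := pow2_gt0 n.
by rewrite /weight ler_peMl ?(ltW p)// ler_pM2r.
Qed.

Lemma pow2_bounds n (t : T) : 2 ^+ n <= (2 ^+ n : R) <= 2 * 2 ^+ n.
Proof. by rewrite lexx ler_peMl ?(ltW (pow2_gt0 n))// ler1n. Qed.


(** The operators of the example are used only through their domain and their
    coordinates. *)
Definition acts_as (S : operator H) (w : nat -> T -> R) (sg : T -> T) : Prop :=
  (forall x, op_dom S x <-> decay x) /\
  (forall x n t, decay x -> S x n t = (w n t)%:C * x n (sg t)).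

Lemma weighted_involution_exists (w : nat -> T -> R) (sg : T -> T) :
  involutive sg -> (forall n t, w n (sg t) = w n t) ->
  (forall n t, 2 ^+ n <= w n t <= 2 * 2 ^+ n) ->
  exists S : operator H, self_adjoint S /\ acts_as S w sg.
Proof.
move=> sgK wsg wb; exists (wop w sg); split; first exact: wop_self_adjoint.
have dE x := wdom_decay x sgK wb.
split=> [x|x n t dx]; first exact: dE.
exact: (@wopE _ _ w sg x n t ((dE x).2 dx)).
Qed.

Lemma decay_delta n t : decay (@delta R T n t).
Proof.
apply/asboolP; apply: (@sqsummable_fin _ _ _ n.+1) => m s nm.
by rewrite /= gtn_eqF// mulr0.
Qed.

Lemma acts_as_unbounded (S : operator H) (w : nat -> T -> R) (sg : T -> T) :
  involutive sg -> (forall n t, 2 ^+ n <= w n t) -> acts_as S w sg ->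
  unbounded_op S.
Proof.
move=> sgK wb [dS SE].
apply: (@unbounded_opP _ _ _
  (fun=> (false, false)) (fun=> sg (false, false))) => n.
  by apply/dS; exact: decay_delta.
rewrite SE; last exact: decay_delta.
have w0 := wb n (sg (false, false)).
rewrite sgK /= !eqxx mulr1 normc_def/= expr0n addr0 sqrtr_sqr lecR.
exact: le_trans w0 (ler_norm _).
Qed.

Section AbsoluteValue.
Variables A P : operator H.
Hypothesis hA : acts_as A weight flip_summand.
Hypothesis hP : acts_as P weight idfun.

(** A exchanges the two summands and P does not; as the weight is the same on
    both summands, their squares are both the multiplication by the square of
    the weight. *)
Lemma absolute_value : self_adjoint P -> is_abs_op A P.
Proof.
case: hA hP => dA AE [dP PE] saP.
split => // [x /dP dx|].
  rewrite -[inner _ _]/(rdot (P x) x +i* rdot (P x) ('i%C *: x)).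
  rewrite (@rdot_lin _ _ 0 0 (P x) ('i%C *: x) x x x x); last first.
    move=> n t; rewrite PE// -[('i%C *: x) n t]/('i%C * x n t).
    by case: (x n t) => ? ? /=; ring.
  rewrite !mul0r addr0 lecE/= eqxx/=.
  apply: limr_ge; first by apply: cvg_dotRe; exact: sqsummable_l2.
  apply: nearW => N; apply: sumr_ge0 => n _; apply: sumr_ge0 => t _.
  have w0 : 0 <= weight n t.
    by have /andP[+ _] := weight_bounds n t; apply: le_trans; exact/ltW/pow2_gt0.
  rewrite PE//; case: (x n t) => a b /=.
  rewrite [leRHS](_ : _ = weight n t * (a ^+ 2 + b ^+ 2)); last by ring.
  by rewrite mulr_ge0// addr_ge0// sqr_ge0.
have dAP x : decay x -> decay (A x) <-> decay (P x).
  move=> dx; have flipI := inv_inj flip_summandK.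
  split; apply: (@sqsummable_cmp _ _ _ _ 1 flip_summand flipI) => n t.
    by rewrite PE// AE// flip_summandK mul1r.
  by rewrite PE// AE// mul1r.
have sq x : decay x -> decay (A x) -> decay (P x) -> P (P x) = A (A x).
  by move=> dx dAx dPx; apply: l2_eqP => n t; rewrite !PE// !AE// flip_summandK.
apply/seteqP; split=> -[x y].
- case=> -[/dP dx /dP dPx] /= ->; have dAx := (dAP x dx).2 dPx.
  by split; [split; apply/dA|exact: sq].
- case=> -[/dA dx /dA dAx] /= ->; have dPx := (dAP x dx).1 dAx.
  by split; [split; apply/dP|exact/esym/sq].
Qed.

End AbsoluteValue.

Definition twisted (B : operator H) : Prop :=
  [/\ forall x, op_dom B x <-> decay (straighten x),
      forall x n b, op_dom B x ->
        B x n (false, b) = (2 ^+ n)%:C * x n (false, ~~ b)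
    & forall x, first_summand x -> op_dom B x -> first_summand (B x)].

(** The operator is L^* (D (x) swap) L, with L the map [straighten]. As L fixes
    the summand [false] and preserves the summand [true], so does its adjoint,
    which leaves D (x) swap unchanged on the summand [false]. *)
Lemma twisted_exists : exists B : operator H, self_adjoint B /\ twisted B.
Proof.
have M0 : 0 <= 16%:R :> R by [].
have [W LW] := adjoint_exists M0 (@straighten_bounded R).
have [Wi LWi] := adjoint_exists M0 (@unstraighten_bounded R).
have [B0 [saB0 [dB0 B0E]]] :=
  @weighted_involution_exists (fun n _ => 2 ^+ n) _ flip_coordK
    (fun _ _ => erefl) pow2_bounds.
exists (conj_op B0 LW); split.
  apply: (@conj_self_adjoint _ _ B0 _ W LW _ Wi _ LWi _ _ M0) => //.
  - exact: straightenK.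
  - exact: unstraightenK.
  - by move=> x y; rewrite -linearB; exact: unstraighten_bounded.
have dB x : op_dom (conj_op B0 LW) x <-> decay (straighten x) := dB0 _.
have BE x : conj_op B0 LW x = W (B0 (straighten x)) by [].
split=> // [x n b xd|x lx xd]; have dx := (dB x).1 xd; rewrite BE.
  by rewrite (adj_false LW) B0E// straighten_false.
rewrite straighten_first// in dx *.
have lB : first_summand (B0 x) by move=> n b; rewrite B0E// lx mulr0.
by rewrite (adj_first LW).
Qed.

Section Commutators.
Variables A P B : operator H.
Hypothesis hA : acts_as A weight flip_summand.
Hypothesis hP : acts_as P weight idfun.
Hypothesis hB : twisted B.

Lemma twisted_unbounded : unbounded_op B.
Proof.
case: hB => dB BE _.
have Bd n : op_dom B (@delta R T n (false, false)).
  apply/dB; rewrite straighten_first; last exact: first_summand_delta.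
  exact: decay_delta.
apply: (@unbounded_opP _ _ _ (fun=> (false, false)) (fun=> (false, true))) => n //.
rewrite BE//= !eqxx mulr1 normc_def/= expr0n addr0 sqrtr_sqr lecR.
exact: ler_norm.
Qed.

(** A vector x of the domain satisfies [decay] and so does its image by L, hence
    x lives on the summand [false]. Its image A x lives on the summand [true]
    and satisfies [decay] together with L (A x), so it is 0 for the same
    reason. *)
Lemma commutator_dom0 x : op_dom (A * B - B * A)%op x -> x = 0.
Proof.
case: hA hB => dA AE [dB BE _].
case=> -[Bx /dA dBx] [/dA dx /dB dLAx].
have lx : first_summand x := straighten_decay dx ((dB x).1 Bx).
have dAx : decay (A x).
  have sgI : injective (flip_summand \o flip_coord).
    by apply: inj_comp; [exact: inv_inj flip_summandK | exact: inv_inj flip_coordK].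
  apply: (@sqsummable_cmp _ _ _ _ 4 _ sgI _ dBx) => n [[] b]; rewrite AE//.
    rewrite -[flip_summand _]/(false, b).
    rewrite -[(flip_summand \o flip_coord) _]/(false, ~~ b) BE// negbK.
    rewrite !normsqM !normsq_real [leRHS]mulrCA ler_wpM2l ?sqr_ge0//.
    rewrite mulrA ler_wpM2r ?normsq_ge0//.
    have -> : 4 * (2 ^+ n) ^+ 2 = (2 * 2 ^+ n) ^+ 2 :> R.
      by move: (2 ^+ n) => u; ring.
    have /andP[w1 w2] := weight_bounds n (true, b).
    have w0 := le_trans (ltW (pow2_gt0 n)) w1.
    by rewrite ler_pXn2r// nnegrE (le_trans w0).
  rewrite -[flip_summand _]/(true, b) lx !mulr0 [leLHS](_ : _ = 0).
    by rewrite mulr_ge0 ?normsq_ge0.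
  by rewrite /normsq/= expr0n addr0.
have lAx := straighten_decay dAx dLAx.
apply: l2_eqP => n [[] b]; first exact: lx.
have := lAx n b; rewrite AE// => /eqP; rewrite mulf_eq0 => /orP[|/eqP//].
have /andP[+ _] := weight_bounds n (true, b); have := pow2_gt0 n.
move=> /lt_le_trans/[apply] w0; rewrite eq_complex/= => /andP[/eqP w00 _].
by rewrite w00 ltxx in w0.
Qed.

Lemma commutator_bounded : bounded_op (A * B - B * A)%op.
Proof.
exists 0; split => // x /commutator_dom0 ->.
by rewrite op0 normr0 mul0r.
Qed.

Lemma commutator_closed : closed_op (A * B - B * A)%op.
Proof.
rewrite /closed_op (_ : graph _ = [set (0, 0)]).
  exact/accessible_closed_set1/hausdorff_accessible/norm_hausdorff.
apply/seteqP; split=> -[x y].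
  case=> /commutator_dom0 /= -> ->; congr (_, _).
  exact: (op0 (A * B - B * A)%op).
by case=> -> ->; split; [exact: op_dom0|rewrite op0].
Qed.

(** The off-diagonal entries of the commutator of diag (1, 2) and the swap. *)
Definition scale_gap b : R := scale (false, b) - scale (false, ~~ b).

(** On the summand [true] the domain is trivial as before; on the summand
    [false] the commutator of D (x) diag (1, 2) and D (x) swap is the invertible
    matrix of entries [scale_gap] times D ^ 2. Since the entries are 1 and -1,
    square-summability of the value y is that of D ^ 2 x, and this implies all
    the domain conditions. The right-hand side is a family of linear equations
    between coordinates, which makes the graph visibly closed. *)
Lemma commutator_graph :
  graph (P * B - B * P)%op = [set p : H * H | forall i : nat * bool,
    [/\ p.1 i.1 (true, i.2) = 0, p.2 i.1 (true, i.2) = 0 &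
        p.2 i.1 (false, i.2) =
          (scale_gap i.2 * (2 ^+ i.1) ^+ 2)%:C * p.1 i.1 (false, ~~ i.2)]].
Proof.
case: hP hB => dP PE [dB BE lB].
have lP x : first_summand x -> decay x -> first_summand (P x).
  by move=> lx dx n b; rewrite PE// lx mulr0.
have value x : first_summand x -> decay x -> op_dom B x -> decay (B x) ->
    op_dom B (P x) -> forall n b,
    [/\ P (B x) n (true, b) - B (P x) n (true, b) = 0 &
        P (B x) n (false, b) - B (P x) n (false, b) =
          (scale_gap b * (2 ^+ n) ^+ 2)%:C * x n (false, ~~ b)].
  move=> lx dx Bx dBx BPx n b; split.
    rewrite PE// (lB _ lx Bx) mulr0 (lB _ _ BPx) ?subrr//; exact: lP.
  rewrite PE// BE// BE// PE// !mulrA -!rmorphM -mulrBl -rmorphB/=.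
  by congr (_%:C * _); rewrite /scale_gap /weight; ring.
apply/seteqP; split=> -[x y].
  case=> -[[Bx /dP dBx] [/dP dx BPx]] /= -> [n b].
  have lx : first_summand x := straighten_decay dx ((dB x).1 Bx).
  have [v1 v2] := value x lx dx Bx dBx BPx n b.
  by split; [exact: lx|exact: v1|exact: v2].
move=> /= xy.
have lx : first_summand x by move=> n b; have [] := xy (n, b).
have yE n b :
    y n (false, b) = (scale_gap b * (2 ^+ n) ^+ 2)%:C * x n (false, ~~ b).
  by have [] := xy (n, b).
have y0 n b : y n (true, b) = 0 by have [] := xy (n, b).
have idI : injective (@idfun T) by [].
have flip_coordI := inv_inj flip_coordK.
have n00 : normsq (0 : R[i]) = 0 by rewrite /normsq/= expr0n addr0.
have d2 : sqsummable (fun n t => ((2 ^+ n) ^+ 2)%:C * x n t).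
  have sy := @sqsummable_l2 R T y.
  apply: (@sqsummable_cmp R T _ _ 1 flip_coord flip_coordI _ sy) => n [[] b].
    by rewrite lx mulr0 n00 mul1r normsq_ge0.
  rewrite -[flip_coord _]/(false, ~~ b) yE negbK mul1r !normsqM !normsq_real.
  rewrite [(scale_gap _ * _) ^+ 2]exprMn.
  rewrite (_ : scale_gap (~~ b) ^+ 2 = 1) ?mul1r//.
  by rewrite /scale_gap /scale; case: b => /=; ring.
have dx : decay x.
  apply: (@sqsummable_cmp _ _ _ _ 1 _ idI _ d2) => n t.
  rewrite mul1r; apply: normsq_mulr_le; first exact/ltW/pow2_gt0.
  by rewrite expr2 ler_peMl ?(ltW (pow2_gt0 n))// exprn_ege1// ler1n.
have Bx : op_dom B x by apply: (dB x).2; rewrite straighten_first.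
have dBx : decay (B x).
  apply: (@sqsummable_cmp _ _ _ _ 1 _ flip_coordI _ d2) => n [[] b].
    by rewrite (lB _ lx Bx) mulr0 n00 mul1r normsq_ge0.
  by rewrite BE// mulrA -rmorphM -expr2 mul1r.
have dPx : decay (P x).
  apply: (@sqsummable_cmp _ _ _ _ 4 _ idI _ d2) => n t; rewrite PE//=.
  rewrite mulrA -rmorphM/=.
  have /andP[w1 w2] := weight_bounds n t; have p := pow2_gt0 n.
  have w0 := le_trans (ltW p) w1.
  apply: le_trans (_ : normsq ((2 * (2 ^+ n) ^+ 2)%:C * x n t) <= _).
    apply: normsq_mulr_le; first by rewrite mulr_ge0// ltW.
    by rewrite expr2 [leRHS]mulrCA ler_pM2l.
  rewrite rmorphM/= -mulrA normsqM normsq_real (_ : 2 ^+ 2 = 4)//.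
  by rewrite -natrX.
have BPx : op_dom B (P x).
  by apply: (dB _).2; rewrite straighten_first//; exact: lP.
split; first by split; split=> //; [exact: (dP _).2|exact: (dP _).2].
apply: l2_eqP => n [[] b] /=; have [v1 v2] := value x lx dx Bx dBx BPx n b.
  by rewrite y0; exact/esym/v1.
by rewrite yE; exact/esym/v2.
Qed.

Lemma abs_commutator_closed : closed_op (P * B - B * P)%op.
Proof.
rewrite /closed_op commutator_graph; apply: closed_forall => -[n b] /=.
have -> : (fun p : H * H => [/\ p.1 n (true, b) = 0, p.2 n (true, b) = 0 &
      p.2 n (false, b) =
        (scale_gap b * (2 ^+ n) ^+ 2)%:C * p.1 n (false, ~~ b)]) =
    [set p : H * H | 0 * p.2 n (true, b) = 1 * p.1 n (true, b)] `&`
    [set p : H * H | 1 * p.2 n (true, b) = 0 * p.1 n (true, b)] `&`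
    [set p : H * H | 1 * p.2 n (false, b) =
      (scale_gap b * (2 ^+ n) ^+ 2)%:C * p.1 n (false, ~~ b)].
  apply/funext => p; apply/propext; rewrite /setI/= !mul0r !mul1r.
  by split=> [[-> -> ->]//|[[-> ->] ->]].
by apply: closedI; [apply: closedI|]; exact: closed_coord.
Qed.

Lemma abs_commutator_unbounded : unbounded_op (P * B - B * P)%op.
Proof.
have G n : graph (P * B - B * P)%op (@delta R T n (false, false),
    ((2 ^+ n) ^+ 2)%:C *: @delta R T n (false, true)).
  rewrite commutator_graph => -[m b]; split; [exact: first_summand_delta| |].
    rewrite -[LHS]/(((2 ^+ n) ^+ 2)%:C * @delta R T n (false, true) m (true, b)).
    by rewrite first_summand_delta mulr0.
  rewrite -[LHS]/(((2 ^+ n) ^+ 2)%:C * ((m == n) && (b == true))%:R).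
  rewrite -[l2val _ _ _]/(((m == n) && (~~ b == false))%:R : R[i]).
  have [->|] := eqVneq m n; last by rewrite /= !mulr0.
  case: b; rewrite /= ?mulr0// !mulr1; congr (_%:C).
  by rewrite /scale_gap /scale/=; ring.
apply: (@unbounded_opP _ _ _ (fun=> (false, false)) (fun=> (false, true))) => n.
  by have [] := G n.
have [_ yE] := G n; move: yE; rewrite [(_, _).1]/= [(_, _).2]/= => <-.
rewrite -[l2val _ _ _]/(((2 ^+ n) ^+ 2)%:C * ((n == n) && (true == true))%:R).
rewrite !eqxx mulr1 normc_def/= expr0n addr0 sqrtr_sqr lecR.
apply: le_trans (ler_norm _); rewrite expr2 ler_peMl ?(ltW (pow2_gt0 n))//.
by rewrite exprn_ege1// ler1n.
Qed.

End Commutators.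
End Counterexample.

Theorem proposition2p4 (R : realType) :
  exists (H : hilbertType R) (A B absA : operator H),
    [/\ self_adjoint A /\ unbounded_op A,
        self_adjoint B /\ unbounded_op B,
        is_abs_op A absA,
        bounded_op (A * B - B * A)%op /\ closed_op (A * B - B * A)%op &
        unbounded_op (absA * B - B * absA)%op /\
        closed_op (absA * B - B * absA)%op].
Proof.
have [A [saA hA]] :=
  @weighted_involution_exists R (@weight R) flip_summand flip_summandK
    (fun _ _ => erefl) (@weight_bounds R).
have [P [saP hP]] := @weighted_involution_exists R (@weight R) idfun
  (fun _ => erefl) (fun _ _ => erefl) (@weight_bounds R).
have [B [saB hB]] := twisted_exists R.
exists (l2 R (bool * bool)%type), A, B, P; split.
- split=> //; apply: (acts_as_unbounded flip_summandK _ hA) => n t.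
  by have /andP[] := weight_bounds R n t.
- by split=> //; exact: twisted_unbounded hB.
- exact: absolute_value hA hP saP.
- by split; [exact: commutator_bounded hA hB|exact: commutator_closed hA hB].
- by split; [exact: abs_commutator_unbounded hP hB
            |exact: abs_commutator_closed hP hB].
Qed.
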